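(* Let $G$ be a connected graph with the following four properties: (P1) $\chi(N_1(u,v))\ge 2$ for any two nonadjacent (distinct) vertices $u$ and $v$ of $G$; (P2) $|V(G)|\le 3\alpha_1(G)-3$; (P3) $\alpha_2(G)<2\alpha_1(G)$; (P4) $\chi(G)\ge 3$. Then $$\chi_c(G)\ge \frac{|V(G)|}{\alpha_1(G)-\frac{2}{3}}.$$
   Context: Graphs are finite, simple and undirected. For positive integers $k\ge 2d$, a $(k,d)$-coloring of $G$ is a map $f:V(G)\to\{0,1,\dots,k-1\}$ such that $d\le |f(x)-f(y)|\le k-d$ for every edge $xy$; $G$ is $(k,d)$-colorable if it has one. The circular chromatic number is $\chi_c(G)=\inf\{k/d: G\text{ is }(k,d)\text{-colorable}\}$. For $S\subseteq V(G)$, $N_1(S)=\{w\in V(G)\setminus S: ws\in E(G)\text{ for some }s\in S\}$, and $N_1(u,v)=N_1(\{u,v\})$. $\chi(G)$ is the (ordinary) chromatic number, and $\chi(S)$ for $S\subseteq V(G)$ denotes the chromatic number of the subgraph induced by $S$. $\alpha_k(G)$ is the maximum number of vertices in a vertex-induced $k$-colorable subgraph of $G$; in particular $\alpha_1(G)$ is the independence number. *)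

(* Defs.v *)
From mathcomp Require Import all_boot all_order all_algebra.
From mathcomp Require Import classical_sets reals zify.
Set Implicit Arguments.
Unset Strict Implicit.
Unset Printing Implicit Defensive.
Import Order.TTheory GRing.Theory Num.Theory.

Record sgraph := SGraph {
  vertex :> finType;
  adj : rel vertex;
  adj_sym : symmetric adj;
  adj_irr : irreflexive adj }.

(* The graph without vertices is accepted here. *)
Definition connected_graph (G : sgraph) : Prop :=
  forall x y : G, connect (@adj G) x y.

Section Induced.
Variables (G : sgraph) (S : {set G}).
Definition induced_adj : rel {x : G | x \in S} := relpre val (@adj G).
Lemma induced_sym : symmetric induced_adj.
Proof. by move=> x y; apply: adj_sym. Qed.
Lemma induced_irr : irreflexive induced_adj.
Proof. by move=> x; apply: adj_irr. Qed.
Definition induced : sgraph := SGraph induced_sym induced_irr.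
End Induced.

Definition colorable (G : sgraph) (k : nat) : bool :=
  [exists f : {ffun G -> 'I_k},
    [forall x : G, [forall y : G, adj x y ==> (f x != f y)]]].

Lemma colorable_card (G : sgraph) : exists k, colorable G k.
Proof.
exists #|G|; apply/existsP; exists [ffun x => enum_rank x].
apply/forallP=> x; apply/forallP=> y; apply/implyP=> xy; rewrite !ffunE.
by apply: contraTneq xy => /enum_rank_inj ->; rewrite adj_irr.
Qed.

Definition chi (G : sgraph) : nat := ex_minn (colorable_card G).

Definition alpha (k : nat) (G : sgraph) : nat :=
  \max_(S : {set G} | colorable (induced S) k) #|S|.

Definition N1 (G : sgraph) (S : {set G}) : {set G} :=
  [set w in ~: S | [exists s in S, adj w s]].

Definition kd_colorable (G : sgraph) (k d : nat) : Prop :=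
  exists f : G -> 'I_k, forall x y : G, adj x y ->
    (d%:Z <= `|(f x)%:Z - (f y)%:Z| <= k%:Z - d%:Z)%R.

Definition circular_ratios (R : realType) (G : sgraph) : set R :=
  [set r : R | exists k d : nat,
    [/\ 0 < d, 2 * d <= k, kd_colorable G k d & r = (k%:R / d%:R)%R]]%classic.
Arguments circular_ratios : clear implicits.

(* [inf] is 0 by default on a set that is empty or not bounded below; neither
   occurs here: see [circular_ratios_has_inf]. *)
Definition chi_c (R : realType) (G : sgraph) : R := inf (circular_ratios R G).

Lemma circular_ratios_has_inf (R : realType) (G : sgraph) :
  has_inf (circular_ratios R G).
Proof.
split; last by exists 0%R => _ [k [d [_ _ _ ->]]]; rewrite divr_ge0 ?ler0n.
exists (#|G|.+2%:R / 1%:R)%R; exists #|G|.+2, 1%N; split=> //.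
exists (fun x => widen_ord (leqW (leqnSn _)) (enum_rank x)) => x y xy /=.
have : enum_rank x != enum_rank y :> nat.
  by apply: contraTneq xy => /val_inj/enum_rank_inj ->; rewrite adj_irr.
have := ltn_ord (enum_rank x); have := ltn_ord (enum_rank y).
move: (enum_rank x : nat) (enum_rank y : nat) => a b; move: #|_| => n.
by case: (ltgtP a b) => // ab lb la _; apply/andP; split; lia.
Qed.

(* Main.v *)
Require Import Defs.
From mathcomp Require Import all_boot all_order all_algebra.
From mathcomp Require Import classical_sets reals.
From mathcomp Require Import zify lra.
Import Order.TTheory GRing.Theory Num.Theory.

(** Let [n] be the order of [G] and [a] its independence number; fix a
    [(k, d)]-coloring [f] with [2 d <= k].  The claim is that [k / d] is at
    least [n / (a - 2/3)], that is, [3 n d <= k (3 a - 2)].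

    If [3 d <= k], this follows from [n <= 3 a - 3].  Otherwise put
    [s = 3 d - k > 0] and place the vertices on a circle of length [k]
    according to their colors.  The neighbors of a vertex of color [c] lie on
    the arc from [c + d] to [c - d], of length [k - 2 d].  So for two vertices
    at circular distance [j < s], all neighbors of either one lie on an arc of
    length [k - 2 d + j < d], and hence form an independent set; also, the two
    vertices are not adjacent, since [s <= d].  Hypothesis [P1] excludes this,
    so distinct vertices are at distance at least [s]
    ([close_colors_eq]).  Disjoint arcs of [s] colors thus start at the [n]
    vertices, whence [n s <= k] ([card_mul_gap_le]), that is,
    [(n + 1) (3 d - k) <= 3 d], or [3 n d <= k (n + 1)].  Now
    [n + 1 <= 3 a - 2] finishes the proof. *)

Lemma chi_le (G : sgraph) (k : nat) : colorable G k -> chi G <= k.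
Proof. by rewrite /chi => Gk; case: ex_minnP => m _; apply. Qed.

Lemma chi_edgeless (G : sgraph) : (forall x y : G, ~~ adj x y) -> chi G <= 1.
Proof.
move=> no_edge; apply: chi_le; apply/existsP; exists [ffun=> ord0].
by apply/forallP=> x; apply/forallP=> y; rewrite (negbTE (no_edge x y)).
Qed.

Section DenseColoring.

Variables (G : sgraph) (k d : nat) (f : G -> 'I_k).
Hypothesis le_2d_k : 2 * d <= k.
Hypothesis lt_k_3d : k < 3 * d.
Hypothesis f_col : forall x y : G, adj x y ->
  (d%:Z <= `|(f x)%:Z - (f y)%:Z| <= k%:Z - d%:Z)%R.
Hypothesis N1_chi : forall u v : G, u != v -> ~~ adj u v ->
  2 <= chi (induced (N1 [set u; v])).

(** The neighbors of [x] and [y] have their colors on the arc from [f x + d]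
    to [f x + j + k - d], which is too short to contain the colors of two
    adjacent vertices; so [N1 [set x; y]] would be independent. *)
Lemma close_colors_eq (x y : G) (j : nat) :
  j < 3 * d - k -> (f y = f x + j :> nat) \/ (f y + k = f x + j) -> x = y.
Proof.
move=> lt_j_s xy_j; apply/eqP; apply: contraT => neq_xy.
have ltx := ltn_ord (f x); have lty := ltn_ord (f y).
have nadj_xy : ~~ adj x y by apply/negP => /f_col; lia.
have := N1_chi _ _ neq_xy nadj_xy; rewrite ltnNge chi_edgeless // => -[w wN] [z zN].
apply/negP; rewrite /= /induced_adj /= => /f_col.
have nbr u : u \in N1 [set x; y] -> adj u x \/ adj u y.
  rewrite inE => /andP[_ /existsP[t /andP[]]].
  by rewrite !inE => /orP[]/eqP->; [left | right].
have ltw := ltn_ord (f w); have ltz := ltn_ord (f z).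
by case: (nbr w wN) => /f_col; case: (nbr z zN) => /f_col; lia.
Qed.

(** The arcs [f x, ..., f x + s - 1] modulo [k], with [s = 3 d - k], are
    pairwise disjoint, which is the injectivity of
    [(x, i) |-> (f x + i) mod k]. *)
Lemma card_mul_gap_le : #|G| * (3 * d - k) <= k.
Proof.
have k_gt0 : 0 < k by lia.
pose arc (p : G * 'I_(3 * d - k)) := Ordinal (ltn_pmod (f p.1 + p.2) k_gt0).
rewrite -[leqRHS]card_ord -[X in _ * X]card_ord -card_prod.
apply: (@leq_card _ _ arc).
(* Wrapping around happens at most once, since [s <= k]. *)
have wrap x (i : 'I_(3 * d - k)) :
    (arc (x, i) = f x + i :> nat) \/ (arc (x, i) + k = f x + i).
  have ltx := ltn_ord (f x); have lti := ltn_ord i.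
  rewrite /=; have [lt_k | ge_k] := ltnP (f x + i) k.
    by left; rewrite modn_small.
  by right; rewrite -{1}(subnK ge_k) modnDr modn_small ?subnK //; lia.
have arc_inj x y (i j : 'I_(3 * d - k)) :
    j <= i -> arc (x, i) = arc (y, j) -> (x, i) = (y, j).
  move=> le_ji eq_arc; have lti := ltn_ord i.
  have := wrap x i; have := wrap y j; rewrite eq_arc => wy wx.
  have ltx := ltn_ord (f x); have lty := ltn_ord (f y).
  have lta := ltn_ord (arc (y, j)).
  move: (arc (y, j) : nat) lta wx wy => c lta wx wy.
  have eq_xy : x = y by apply: (@close_colors_eq x y (i - j)); lia.
  by rewrite eq_xy in wx ltx *; congr (_, _); apply: val_inj => /=; lia.
move=> [x i] [y j] eq_arc; case: (leqP j i) => [|/ltnW] le_ij.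
  exact: arc_inj.
by symmetry; apply: arc_inj.
Qed.

End DenseColoring.

Theorem theorem12 (R : realType) (G : sgraph)
  (Gconn : connected_graph G)
  (P1 : forall u v : G, u != v -> ~~ adj u v ->
          2 <= chi (induced (N1 [set u; v])))
  (P2 : (#|G|%:Z <= 3 * (alpha 1 G)%:Z - 3)%R)
  (P3 : alpha 2 G < 2 * alpha 1 G)
  (P4 : 3 <= chi G) :
  (#|G|%:R / ((alpha 1 G)%:R - 2%:R / 3%:R) <= chi_c R G)%R.
Proof.
apply: lb_le_inf; first by case: (circular_ratios_has_inf R G).
move=> _ [k [d [d_gt0 le_2d_k [f f_col] ->]]].
(* The claimed [3 n d <= k (3 a - 2)], with denominators cleared and without
   truncated subtraction. *)
have bound : 3 * (#|G| * d) + 2 * k <= 3 * (k * alpha 1 G).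
  have [le_3d_k | lt_k_3d] := leqP (3 * d) k; first by nia.
  by have := card_mul_gap_le _ _ _ _ le_2d_k lt_k_3d f_col P1; nia.
have a_gt0 : 0 < alpha 1 G by lia.
move: bound; rewrite -(ler_nat R) !natrD !natrM => bound.
have a_ge1 : (1 <= (alpha 1 G)%:R :> R)%R by rewrite ler1n.
rewrite ler_pdivrMr; last by lra.
by rewrite mulrAC ler_pdivlMr ?ltr0n //; lra.
Qed.
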